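(* Let $g>0$, $\alpha>0$, $\underline c>0$, $p_0<0$, $\gamma\in C^{1+\beta}([0,|p_0|])$ with $\beta\in(0,1)$, $\mu>-2\Gamma_{\min}$, and let $U(y)$, $y\in[0,h]$, be the associated shear flow defined in the context. Then $\underline c>\max U$, and the bifurcation equation $$\begin{cases}(a^3M_p)_p=\alpha^2aM&\text{for }p\in(p_0,0),\\ \mu^{3/2}M_p(0)=gM(0),\\ M(p_0)=0,\end{cases}\qquad a=a(\mu;p)=\sqrt{\mu+2\Gamma(p)},$$ is equivalent, via $\phi(y)=(\underline c-U(y))M(p(y))$, to the Rayleigh equation $$(U-c)(\phi''-k^2\phi)-U''\phi=0\quad\text{for }y\in(0,h)$$ with the boundary conditions $$\phi'(h)=\Big(\frac{g}{(U(h)-c)^2}+\frac{U'(h)}{U(h)-c}\Big)\phi(h),\qquad\phi(0)=0,$$ where $(c,k)=(\underline c,\alpha)$.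
   Context: $\Gamma(p)=\int_0^p\gamma(-p')\,dp'$ for $p\in[p_0,0]$ and $\Gamma_{\min}=\min_{[p_0,0]}\Gamma\le0$. For $\mu>-2\Gamma_{\min}$ set $y(p)=\int_{p_0}^p\frac{dp'}{\sqrt{\mu+2\Gamma(p')}}$, $h=h(\mu)=y(0)$, let $p(y)$, $y\in[0,h]$, be the inverse function of $y(p)$, and define the shear flow $U(y)=\underline c-\sqrt{\mu+2\Gamma(p(y))}$. Primes denote $d/dy$. *)

(* Defs.v *)
From Stdlib Require Import Reals.
From Coquelicot Require Import Coquelicot.
Open Scope R_scope.

(* Functions on a closed interval [a, b] are represented by functions on R of
   which only the restriction to [a, b] matters.  Derivatives up to the boundary
   are therefore taken relative to [a, b] ([D_in]): they are one-sided at the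
   endpoints. *)
Definition itv (a b x : R) : Prop := a <= x <= b.

Definition derive_on (a b : R) (f f1 : R -> R) : Prop :=
  forall x, itv a b x -> D_in f f1 (itv a b) x.

Definition cont_on (a b : R) (f : R -> R) : Prop :=
  forall x, itv a b x -> continue_in f (itv a b) x.

(* f is in C^{1+beta}([a, b]). *)
Definition C1_holder (a b beta : R) (f : R -> R) : Prop :=
  exists f1 : R -> R,
    derive_on a b f f1 /\
    exists K : R, forall x y, itv a b x -> itv a b y -> x <> y ->
      Rabs (f1 x - f1 y) <= K * Rpower (Rabs (x - y)) beta.

(* f is in C^1([a, b]) and in C^2((a, b)), with f' = f1 on [a, b] and f'' = f2
   on (a, b). *)
Definition C1C2 (a b : R) (f f1 f2 : R -> R) : Prop :=
  derive_on a b f f1 /\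
  cont_on a b f1 /\
  (forall x, a < x < b -> is_derive f1 x (f2 x)) /\
  (forall x, a < x < b -> continuous f2 x).

Definition is_min_on (a b : R) (f : R -> R) (m : R) : Prop :=
  (exists x, itv a b x /\ f x = m) /\ (forall x, itv a b x -> m <= f x).

Definition is_max_on (a b : R) (f : R -> R) (m : R) : Prop :=
  (exists x, itv a b x /\ f x = m) /\ (forall x, itv a b x -> f x <= m).

Definition Gam (gamma : R -> R) (p : R) : R := RInt (fun q => gamma (- q)) 0 p.

Definition afun (gamma : R -> R) (mu p : R) : R := sqrt (mu + 2 * Gam gamma p).

Definition yfun (gamma : R -> R) (p0 mu p : R) : R :=
  RInt (fun q => / afun gamma mu q) p0 p.

Definition depth (gamma : R -> R) (p0 mu : R) : R := yfun gamma p0 mu 0.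

(* pinv : [0, h] -> [p0, 0] is the inverse function of yfun : [p0, 0] -> [0, h];
   the values of pinv outside [0, h] are arbitrary. *)
Definition is_inverse_y (gamma : R -> R) (p0 mu : R) (pinv : R -> R) : Prop :=
  (forall p, itv p0 0 p ->
     itv 0 (depth gamma p0 mu) (yfun gamma p0 mu p) /\
     pinv (yfun gamma p0 mu p) = p) /\
  (forall y, itv 0 (depth gamma p0 mu) y ->
     itv p0 0 (pinv y) /\ yfun gamma p0 mu (pinv y) = y).

Definition shear (gamma : R -> R) (c mu : R) (pinv : R -> R) (y : R) : R :=
  c - sqrt (mu + 2 * Gam gamma (pinv y)).

Definition bifurcation_solution (gamma : R -> R) (p0 g alpha mu : R)
    (M : R -> R) : Prop :=
  exists Mp Mpp : R -> R,
    C1C2 p0 0 M Mp Mpp /\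
    (forall p, p0 < p < 0 ->
       is_derive (fun q => afun gamma mu q ^ 3 * Mp q) p
                 (alpha ^ 2 * afun gamma mu p * M p)) /\
    Rpower mu (3 / 2) * Mp 0 = g * M 0 /\
    M p0 = 0.

(* U1 and U2 stand for U' and U''. *)
Definition rayleigh_solution (h g : R) (U U1 U2 : R -> R) (c k : R)
    (phi : R -> R) : Prop :=
  exists phi1 phi2 : R -> R,
    C1C2 0 h phi phi1 phi2 /\
    (forall y, 0 < y < h ->
       (U y - c) * (phi2 y - k ^ 2 * phi y) - U2 y * phi y = 0) /\
    phi1 h = (g / (U h - c) ^ 2 + U1 h / (U h - c)) * phi h /\
    phi 0 = 0.

(* Main.v *)
(** On [[p0, 0]] the relation [a^2 = mu + 2 Gam] gives [a a' = G] with
    [G p = gamma (- p)], and the inverse [P] of [Y] satisfies [P' = a(P)].  Hence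
    [U = c - a(P)] has [U' = - G(P)] and [U'' = - a(P) G'(P)].  For [phi = a(P) M(P)]
    one gets [phi' = (G M + a^2 M_p)(P)]; since [a^2 M_p = (a^3 M_p) / a], the
    bifurcation ODE yields [phi'' = a (G' + alpha^2) M] at [P], which is Rayleigh's
    equation.  Conversely, [M = phi(Y) / a] satisfies
    [a^3 M_p = a phi'(Y) - G phi(Y)], whose derivative is [phi''(Y) + G' phi(Y)].
    At the surface [a(0) = sqrt mu] turns one boundary condition into the other. *)
Require Import Defs.
From Stdlib Require Import Reals Lra.
From Coquelicot Require Import Coquelicot.
Open Scope R_scope.

(** * Calculus relative to a set *)

Lemma D_in_ext (D : R -> Prop) (f g df dg : R -> R) (x : R) :
  D x -> (forall y, D y -> f y = g y) -> df x = dg x ->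
  D_in f df D x -> D_in g dg D x.
Proof.
  intros Dx Hfg Hd H eps Heps.
  destruct (H eps Heps) as [d [Hd0 H1]].
  exists d; split; [exact Hd0|].
  intros y [Hy Hyx]; rewrite <- Hd.
  rewrite <- (Hfg y (proj1 Hy)), <- (Hfg x Dx); auto.
Qed.

(** [Dcomp] differentiates only along the points of [A] that [f] sends into [B]; as [f] maps [A]
    into [B], these are all of [A]. *)
Lemma D_in_comp (A B : R -> Prop) (f g df dg : R -> R) (x : R) :
  (forall y, A y -> B (f y)) ->
  D_in f df A x -> D_in g dg B (f x) ->
  D_in (fun y => g (f y)) (fun y => df y * dg (f y)) A x.
Proof.
  intros HAB Hf Hg eps Heps.
  destruct (Dcomp A B df dg f g x Hf Hg eps Heps) as [d [Hd0 H1]].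
  exists d; split; [exact Hd0|].
  intros y [[HA Hne] Hy]; apply H1; repeat split; auto.
Qed.

Lemma D_in_derivable_pt_lim (D : R -> Prop) (f df : R -> R) (x : R) :
  derivable_pt_lim f x (df x) -> D_in f df D x.
Proof.
  intros H eps Heps.
  destruct (H eps Heps) as [d Hd].
  exists d; split; [apply cond_pos|].
  intros y [[_ Hne] Hy]; simpl in *; unfold Rdist in *.
  replace (f y) with (f (x + (y - x))) by (f_equal; ring).
  apply Hd; [lra | exact Hy].
Qed.

(** A whole neighbourhood of an interior point lies in the interval. This links the relative
    calculus, valid up to the endpoints, with the ODEs, which are posed on open intervals. *)
Lemma D_in_is_derive (a b : R) (f df : R -> R) (x : R) :
  a < x < b -> (D_in f df (itv a b) x <-> is_derive f x (df x)).
Proof.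
  intros Hx; split; intros H.
  - apply is_derive_Reals; intros eps Heps.
    destruct (H eps Heps) as [d [Hd0 H1]].
    assert (Hm : 0 < Rmin d (Rmin (x - a) (b - x)))
      by (repeat apply Rmin_pos; lra).
    exists (mkposreal _ Hm); simpl; intros t Ht0 Ht.
    assert (H2 := Rmin_l d (Rmin (x - a) (b - x))).
    assert (H3 := Rmin_r d (Rmin (x - a) (b - x))).
    assert (H4 := Rmin_l (x - a) (b - x)).
    assert (H5 := Rmin_r (x - a) (b - x)).
    specialize (H1 (x + t)); simpl in H1; unfold Rdist in H1.
    replace (x + t - x) with t in H1 by ring.
    apply H1; split; [|lra].
    unfold D_x, itv; apply Rabs_def2 in Ht; lra.
  - apply D_in_derivable_pt_lim, is_derive_Reals, H.
Qed.

Lemma D_in_scal_l (D : R -> Prop) (f df : R -> R) (k x : R) :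
  D_in f df D x -> D_in (fun y => k * f y) (fun y => k * df y) D x.
Proof.
  intros H; generalize (Dmult_const D f df x k H); auto.
Qed.

Lemma D_in_inv (D : R -> Prop) (f df : R -> R) (x : R) :
  D x -> f x <> 0 -> D_in f df D x ->
  D_in (fun y => / f y) (fun y => - df y / f y ^ 2) D x.
Proof.
  intros Dx H0 H.
  assert (H1 : D_in Rinv (fun y => - 1 / y ^ 2) (fun _ => True) (f x)).
  { apply D_in_derivable_pt_lim, is_derive_Reals.
    auto_derive; [exact H0 | field; exact H0]. }
  refine (D_in_ext _ _ _ _ _ _ Dx (fun _ _ => eq_refl) _
            (D_in_comp D _ f Rinv df _ x (fun _ _ => I) H H1)).
  simpl; field; exact H0.
Qed.

Lemma D_in_sqrt (D : R -> Prop) (f df : R -> R) (x : R) :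
  D x -> 0 < f x -> D_in f df D x ->
  D_in (fun y => sqrt (f y)) (fun y => df y / (2 * sqrt (f y))) D x.
Proof.
  intros Dx H0 H.
  assert (H1 : D_in sqrt (fun y => / (2 * sqrt y)) (fun _ => True) (f x))
    by (apply D_in_derivable_pt_lim, derivable_pt_lim_sqrt, H0).
  exact (D_in_comp D _ f sqrt df _ x (fun _ _ => I) H H1).
Qed.

(** * Continuity relative to a set, in terms of filters *)

Definition cont_in (D : R -> Prop) (f : R -> R) (x : R) : Prop :=
  filterlim f (within D (locally x)) (locally (f x)).

(** [continue_in] is a limit over [D] without the point [x], while the filter keeps [x]; at [x]
    itself the estimate is trivial. *)
Lemma continue_in_cont_in (D : R -> Prop) (f : R -> R) (x : R) :
  continue_in f D x <-> cont_in D f x.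
Proof.
  split; intros H.
  - apply filterlim_locally; intros eps.
    destruct (H eps (cond_pos eps)) as [d [Hd0 H1]].
    exists (mkposreal d Hd0); intros y Hy Dy.
    destruct (Req_dec x y) as [<-|Hne]; [apply ball_center|].
    apply H1; repeat split; auto.
  - intros eps Heps.
    destruct (proj1 (filterlim_locally _ _) H (mkposreal eps Heps)) as [d Hd].
    exists d; split; [apply cond_pos|].
    intros y [[Dy _] Hy]; exact (Hd y Hy Dy).
Qed.

Lemma D_in_cont_in (D : R -> Prop) (f df : R -> R) (x : R) :
  D_in f df D x -> cont_in D f x.
Proof.
  intros H; apply continue_in_cont_in, (cont_deriv _ _ _ _ H).
Qed.

Lemma cont_in_ext (D : R -> Prop) (f g : R -> R) (x : R) :
  D x -> (forall y, D y -> f y = g y) -> cont_in D f x -> cont_in D g x.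
Proof.
  unfold cont_in; intros Dx Hfg H; rewrite <- (Hfg x Dx).
  apply filterlim_within_ext with f; auto.
Qed.

Lemma cont_in_const (D : R -> Prop) (k x : R) : cont_in D (fun _ => k) x.
Proof. apply filterlim_const. Qed.

Lemma cont_in_comp (A B : R -> Prop) (f g : R -> R) (x : R) :
  (forall y, A y -> B (f y)) -> cont_in A f x -> cont_in B g (f x) ->
  cont_in A (fun y => g (f y)) x.
Proof.
  intros HAB Hf Hg.
  apply filterlim_comp with (2 := Hg).
  intros P HP; generalize (Hf _ HP).
  unfold filtermap, within; apply filter_imp; auto.
Qed.

Lemma cont_in_plus (D : R -> Prop) (f g : R -> R) (x : R) :
  cont_in D f x -> cont_in D g x -> cont_in D (fun y => f y + g y) x.
Proof.
  intros Hf Hg; eapply filterlim_comp_2; [exact Hf | exact Hg |].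
  apply (filterlim_plus (V := R_NormedModule) (f x) (g x)).
Qed.

Lemma cont_in_mult (D : R -> Prop) (f g : R -> R) (x : R) :
  cont_in D f x -> cont_in D g x -> cont_in D (fun y => f y * g y) x.
Proof.
  intros Hf Hg; eapply filterlim_comp_2; [exact Hf | exact Hg |].
  apply (filterlim_mult (K := R_AbsRing) (f x) (g x)).
Qed.

Lemma cont_in_interior (a b : R) (f : R -> R) (x : R) :
  a < x < b -> (cont_in (itv a b) f x <-> continuous f x).
Proof.
  intros Hx; split; intros H P HP.
  - assert (Hm : 0 < Rmin (x - a) (b - x)) by (apply Rmin_pos; lra).
    generalize (H P HP); unfold filtermap, within; intros H1.
    apply (filter_imp (fun y => itv a b y /\ (itv a b y -> P (f y)))); [tauto|].
    apply filter_and; [|exact H1].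
    exists (mkposreal _ Hm); intros y Hy; simpl in Hy.
    assert (H4 := Rmin_l (x - a) (b - x)).
    assert (H5 := Rmin_r (x - a) (b - x)).
    change (Rabs (y - x) < Rmin (x - a) (b - x)) in Hy.
    apply Rabs_def2 in Hy; unfold itv; lra.
  - generalize (H P HP); unfold filtermap, within; apply filter_imp; auto.
Qed.

(** * Maxima and integrals of functions continuous on a closed interval *)

Definition clamp (a b x : R) : R := Rmax a (Rmin b x).

Lemma clamp_itv (a b x : R) : a <= b -> itv a b (clamp a b x).
Proof.
  intros H; unfold itv, clamp; split; [apply Rmax_l|].
  apply Rmax_lub; [exact H | apply Rmin_l].
Qed.

Lemma clamp_id (a b x : R) : itv a b x -> clamp a b x = x.
Proof.
  intros [H1 H2]; unfold clamp; rewrite Rmin_right, Rmax_right; auto.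
Qed.

Lemma clamp_continuous (a b x : R) : continuous (clamp a b) x.
Proof.
  (* [clamp] is 1-Lipschitz, so the same [eps] serves as radius. *)
  apply filterlim_locally; intros eps; exists eps; intros y Hy.
  change (Rabs (y - x) < eps) in Hy.
  change (Rabs (clamp a b y - clamp a b x) < eps).
  apply Rabs_def2 in Hy; apply Rabs_def1;
    unfold clamp, Rmax, Rmin; repeat destruct Rle_dec; lra.
Qed.

(** Composing with the retraction [clamp] extends [f] continuously from the interval to all of [R],
    which makes results on everywhere continuous functions applicable. *)
Lemma cont_on_clamp (a b : R) (f : R -> R) :
  a <= b -> cont_on a b f -> forall x, continuous (fun y => f (clamp a b y)) x.
Proof.
  intros Hab Hf x P HP.
  generalize (clamp_continuous a b x); intros Hc.
  assert (H := proj1 (continue_in_cont_in _ _ _) (Hf _ (clamp_itv a b x Hab)) P HP).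
  generalize (Hc _ H); unfold filtermap, within; apply filter_imp.
  intros y Hy; apply Hy, clamp_itv, Hab.
Qed.

Lemma cont_on_max (a b : R) (f : R -> R) :
  a <= b -> cont_on a b f -> exists m, is_max_on a b f m.
Proof.
  intros Hab Hf.
  destruct (continuity_ab_maj (fun y => f (clamp a b y)) a b Hab) as [x [Hx Hi]].
  - intros x _; apply continuity_pt_filterlim, (cont_on_clamp _ _ _ Hab Hf).
  - exists (f x); split; [exists x; split; [exact Hi | reflexivity]|].
    intros y Hy; generalize (Hx y Hy); rewrite !clamp_id; auto.
Qed.

Lemma cont_on_ex_RInt (a b : R) (f : R -> R) (u v : R) :
  cont_on a b f -> itv a b u -> itv a b v -> ex_RInt f u v.
Proof.
  intros Hf Hu Hv.
  assert (Hab : a <= b) by (unfold itv in *; lra).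
  apply ex_RInt_ext with (fun y => f (clamp a b y)).
  - intros x Hx; rewrite clamp_id; [reflexivity|].
    unfold itv, Rmin, Rmax in *; destruct Rle_dec; lra.
  - apply (ex_RInt_continuous (V := R_CompleteNormedModule)).
    intros z _; apply (cont_on_clamp _ _ _ Hab Hf).
Qed.

(** The fundamental theorem of calculus including both endpoints: it holds on [R] for the clamped
    integrand, whose integrals from [u] are unchanged on the interval. *)
Lemma derive_on_RInt (a b : R) (f : R -> R) (u : R) :
  cont_on a b f -> itv a b u -> derive_on a b (fun x => RInt f u x) f.
Proof.
  intros Hf Hu x Hx.
  assert (Hab : a <= b) by (unfold itv in *; lra).
  assert (Hc := cont_on_clamp _ _ _ Hab Hf).
  apply D_in_ext with (fun x => RInt (fun y => f (clamp a b y)) u x)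
                      (fun y => f (clamp a b y)).
  - exact Hx.
  - intros y Hy; apply RInt_ext; intros z Hz; rewrite clamp_id; [reflexivity|].
    unfold itv, Rmin, Rmax in *; destruct Rle_dec; lra.
  - rewrite clamp_id; auto.
  - apply D_in_derivable_pt_lim, is_derive_Reals.
    apply (is_derive_RInt (V := R_NormedModule) (fun y => f (clamp a b y)) _ u);
      [|apply Hc].
    apply filter_forall; intros y.
    apply (RInt_correct (V := R_CompleteNormedModule)).
    apply (ex_RInt_continuous (V := R_CompleteNormedModule)); intros; apply Hc.
Qed.

(** The difference quotient of [P] at [y] is the reciprocal of that of [f] at [P y]. Continuity of
    [P] lets the latter be evaluated along [P z], and [f (P z) = z] makes [P] injective, so no
    denominator vanishes. *)
Lemma D_in_inverse (A B : R -> Prop) (f df P : R -> R) (y : R) :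
  B y -> (forall z, B z -> A (P z) /\ f (P z) = z) ->
  cont_in B P y -> df (P y) <> 0 -> D_in f df A (P y) ->
  D_in P (fun z => / df (P z)) B y.
Proof.
  intros By HP Hc Hd Hf.
  assert (Hne : forall z, B z -> y <> z -> P y <> P z).
  { intros z Bz Hyz E; apply Hyz.
    rewrite <- (proj2 (HP y By)), <- (proj2 (HP z Bz)), E; reflexivity. }
  assert (Hl := limit_inv _ _ _ _
    (limit_comp P (fun x => (f x - f (P y)) / (x - P y)) (D_x B y) (D_x A (P y))
       (P y) (df (P y)) y (proj2 (continue_in_cont_in _ _ _) Hc) Hf) Hd).
  intros eps Heps; destruct (Hl eps Heps) as [d [Hd0 H1]].
  exists d; split; [exact Hd0|].
  intros z [[Bz Hyz] Hz].
  assert (Hn := Hne z Bz Hyz).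
  replace ((P z - P y) / (z - y)) with (/ ((f (P z) - f (P y)) / (P z - P y))).
  - apply H1; split; [|exact Hz].
    split; [split; auto | split; [apply HP, Bz | exact Hn]].
  - rewrite (proj2 (HP y By)), (proj2 (HP z Bz)); field; lra.
Qed.

Lemma holder_cont_on (a b beta K : R) (f : R -> R) :
  0 < beta ->
  (forall x y, itv a b x -> itv a b y -> x <> y ->
     Rabs (f x - f y) <= K * Rpower (Rabs (x - y)) beta) ->
  cont_on a b f.
Proof.
  intros Hb Hf x Hx eps Heps.
  assert (HK : 0 < Rabs K + 1) by (generalize (Rabs_pos K); lra).
  assert (He : 0 < eps / (Rabs K + 1)) by (apply Rdiv_lt_0_compat; lra).
  (* This radius solves [(Rabs K + 1) * d ^ beta = eps]; the constant [Rabs K + 1] is positive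
     whatever the sign of [K]. *)
  exists (Rpower (eps / (Rabs K + 1)) (/ beta)); split; [apply exp_pos|].
  intros y [[Hy Hne] Hyx]; simpl in *; unfold Rdist in *.
  assert (Hp : Rpower (Rabs (y - x)) beta < eps / (Rabs K + 1)).
  { apply Rlt_le_trans with (Rpower (Rpower (eps / (Rabs K + 1)) (/ beta)) beta).
    - apply Rlt_Rpower_l; [lra|]; split; [apply Rabs_pos_lt; lra | exact Hyx].
    - rewrite Rpower_mult, Rinv_l, Rpower_1; lra. }
  assert (Hq : 0 < Rpower (Rabs (y - x)) beta) by apply exp_pos.
  apply Rle_lt_trans with (1 := Hf y x Hy Hx (not_eq_sym Hne)).
  apply Rle_lt_trans with ((Rabs K + 1) * Rpower (Rabs (y - x)) beta).
  - apply Rmult_le_compat_r; [lra|]; generalize (Rle_abs K); lra.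
  - apply Rlt_le_trans with ((Rabs K + 1) * (eps / (Rabs K + 1))).
    + apply Rmult_lt_compat_l; auto.
    + right; field; lra.
Qed.

(** * The change of variables between p and y *)

Lemma Rpower_3_2 (x : R) : 0 < x -> Rpower x (3 / 2) = sqrt x ^ 3.
Proof.
  intros Hx.
  rewrite <- Rpower_pow by (apply sqrt_lt_R0, Hx).
  rewrite <- (Rpower_sqrt x Hx), Rpower_mult; f_equal; simpl; field.
Qed.

(** [G] stands for [p |-> gamma (- p)] and [G1] for its derivative. *)
Record hodograph (p0 h : R) (G G1 a Y P : R -> R) : Prop := {
  hod_p0 : p0 < 0;
  hod_G : derive_on p0 0 G G1;
  hod_G1 : cont_on p0 0 G1;
  hod_pos : forall p, itv p0 0 p -> 0 < a p;
  hod_a : derive_on p0 0 a (fun p => G p / a p);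
  hod_Y : derive_on p0 0 Y (fun p => / a p);
  hod_P : derive_on 0 h P (fun y => a (P y));
  hod_YP : forall p, itv p0 0 p -> itv 0 h (Y p) /\ P (Y p) = p;
  hod_PY : forall y, itv 0 h y -> itv p0 0 (P y) /\ Y (P y) = y;
  hod_bottom : Y p0 = 0;
  hod_surface : Y 0 = h
}.

Arguments hod_p0 {p0 h G G1 a Y P}.
Arguments hod_G {p0 h G G1 a Y P}.
Arguments hod_G1 {p0 h G G1 a Y P}.
Arguments hod_pos {p0 h G G1 a Y P}.
Arguments hod_a {p0 h G G1 a Y P}.
Arguments hod_Y {p0 h G G1 a Y P}.
Arguments hod_P {p0 h G G1 a Y P}.
Arguments hod_YP {p0 h G G1 a Y P}.
Arguments hod_PY {p0 h G G1 a Y P}.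
Arguments hod_bottom {p0 h G G1 a Y P}.
Arguments hod_surface {p0 h G G1 a Y P}.

Section Hodograph.
Context {p0 h : R} {G G1 a Y P : R -> R} (H : hodograph p0 h G G1 a Y P).

Lemma hod_P_bottom : P 0 = p0.
Proof.
  destruct H; rewrite <- hod_bottom0; apply hod_YP0; unfold itv; lra.
Qed.

Lemma hod_P_surface : P h = 0.
Proof.
  destruct H; rewrite <- hod_surface0; apply hod_YP0; unfold itv; lra.
Qed.

Lemma hod_itv : itv 0 h 0 /\ itv 0 h h.
Proof.
  destruct H; rewrite <- hod_bottom0 at 2; rewrite <- hod_surface0 at 3.
  split; apply hod_YP0; unfold itv; lra.
Qed.

(** If [Y p] were an endpoint, then [p = P (Y p)] would be one too. Interior points must correspond
    because each ODE holds only on its open interval. *)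
Lemma hod_Y_interior (p : R) : p0 < p < 0 -> 0 < Y p < h.
Proof.
  intros Hp.
  destruct (hod_YP H p) as [[H1 H2] E]; [unfold itv; lra|].
  split.
  - destruct H1 as [|E0]; [assumption|].
    rewrite <- E0, hod_P_bottom in E; lra.
  - destruct H2 as [|E0]; [assumption|].
    rewrite E0, hod_P_surface in E; lra.
Qed.

Lemma hod_P_interior (y : R) : 0 < y < h -> p0 < P y < 0.
Proof.
  intros Hy.
  destruct (hod_PY H y) as [[H1 H2] E]; [unfold itv; lra|].
  split.
  - destruct H1 as [|E0]; [assumption|].
    rewrite <- E0, (hod_bottom H) in E; lra.
  - destruct H2 as [|E0]; [assumption|].
    rewrite E0, (hod_surface H) in E; lra.
Qed.

(** The rule d/dy = a d/dp, through which derivatives in [y] are computed on the [p] side. *)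
Lemma D_in_hod_P (f df : R -> R) (y : R) :
  itv 0 h y -> D_in f df (itv p0 0) (P y) ->
  D_in (fun z => f (P z)) (fun z => a (P z) * df (P z)) (itv 0 h) y.
Proof.
  intros Hy Hf.
  apply (D_in_comp (itv 0 h) (itv p0 0) P f (fun z => a (P z)) df); auto.
  - intros z Hz; apply (hod_PY H z Hz).
  - apply (hod_P H y Hy).
Qed.

Lemma D_in_hod_Y (f df : R -> R) (p : R) :
  itv p0 0 p -> D_in f df (itv 0 h) (Y p) ->
  D_in (fun q => f (Y q)) (fun q => / a q * df (Y q)) (itv p0 0) p.
Proof.
  intros Hp Hf.
  apply (D_in_comp (itv p0 0) (itv 0 h) Y f (fun q => / a q) df); auto.
  - intros z Hz; apply (hod_YP H z Hz).
  - apply (hod_Y H p Hp).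
Qed.

Lemma cont_in_hod_P (f : R -> R) (y : R) :
  itv 0 h y -> cont_in (itv p0 0) f (P y) -> cont_in (itv 0 h) (fun z => f (P z)) y.
Proof.
  intros Hy; apply (cont_in_comp (itv 0 h) (itv p0 0) P f).
  - intros z Hz; apply (hod_PY H z Hz).
  - apply (D_in_cont_in _ _ _ _ (hod_P H y Hy)).
Qed.

Lemma cont_in_hod_Y (f : R -> R) (p : R) :
  itv p0 0 p -> cont_in (itv 0 h) f (Y p) -> cont_in (itv p0 0) (fun q => f (Y q)) p.
Proof.
  intros Hp; apply (cont_in_comp (itv p0 0) (itv 0 h) Y f).
  - intros z Hz; apply (hod_YP H z Hz).
  - apply (D_in_cont_in _ _ _ _ (hod_Y H p Hp)).
Qed.

Lemma cont_in_hod_a (p : R) : itv p0 0 p -> cont_in (itv p0 0) a p.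
Proof. intros Hp; apply (D_in_cont_in _ _ _ _ (hod_a H p Hp)). Qed.

Lemma cont_in_hod_G (p : R) : itv p0 0 p -> cont_in (itv p0 0) G p.
Proof. intros Hp; apply (D_in_cont_in _ _ _ _ (hod_G H p Hp)). Qed.

Lemma cont_in_hod_G1 (p : R) : itv p0 0 p -> cont_in (itv p0 0) G1 p.
Proof. intros Hp; apply continue_in_cont_in, (hod_G1 H p Hp). Qed.

Lemma cont_in_hod_inv_a (p : R) : itv p0 0 p -> cont_in (itv p0 0) (fun q => / a q) p.
Proof.
  intros Hp; eapply D_in_cont_in, D_in_inv; [exact Hp | |].
  - generalize (hod_pos H p Hp); lra.
  - apply (hod_a H p Hp).
Qed.

Lemma C1C2_shear (c : R) :
  C1C2 0 h (fun y => c - a (P y)) (fun y => - G (P y)) (fun y => - (a (P y) * G1 (P y))).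
Proof.
  (* In [U'] the factor [a] from [P'] cancels the denominator of [a' = G / a]. What remains,
     [- G (P y)], is differentiable up to the boundary, giving both the continuity of [U'] and the
     value of [U'']. *)
  assert (HG : derive_on 0 h (fun y => - G (P y)) (fun y => - (a (P y) * G1 (P y)))).
  { intros y Hy; apply (Dopp _ (fun z => G (P z)) (fun z => a (P z) * G1 (P z))).
    apply D_in_hod_P; [exact Hy|].
    apply (hod_G H), (hod_PY H y Hy). }
  split; [|split; [|split]].
  - intros y Hy; destruct (hod_PY H y Hy) as [Hp _].
    refine (D_in_ext _ _ _ _ _ _ Hy (fun _ _ => eq_refl) _
      (Dminus _ _ _ _ _ _ (Dconst _ c y) (D_in_hod_P a _ y Hy (hod_a H _ Hp)))).
    generalize (hod_pos H _ Hp); intros; simpl; field; lra.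
  - intros y Hy; apply (cont_deriv _ _ _ _ (HG y Hy)).
  - intros y Hy; apply (D_in_is_derive 0 h _ (fun y => - (a (P y) * G1 (P y))) y Hy).
    apply HG; unfold itv; lra.
  - intros y Hy; apply (cont_in_interior 0 h _ y Hy).
    assert (Hy' : itv 0 h y) by (unfold itv; lra).
    destruct (hod_PY H y Hy') as [Hp _].
    apply (cont_in_hod_P (fun p => - (a p * G1 p)) y Hy').
    apply cont_in_ext with (fun p => (-1) * (a p * G1 p)); [exact Hp | intros; ring|].
    repeat apply cont_in_mult;
      [apply cont_in_const | apply cont_in_hod_a, Hp | apply cont_in_hod_G1, Hp].
Qed.

End Hodograph.

(** * Passage between the bifurcation problem and the Rayleigh problem *)

Lemma rayleigh_of_bifurcation (p0 h g alpha c mu : R) (gamma G G1 Y P M phi : R -> R) :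
  hodograph p0 h G G1 (afun gamma mu) Y P ->
  0 < mu -> afun gamma mu 0 = sqrt mu ->
  (forall y, itv 0 h y -> phi y = afun gamma mu (P y) * M (P y)) ->
  bifurcation_solution gamma p0 g alpha mu M ->
  rayleigh_solution h g (fun y => c - afun gamma mu (P y)) (fun y => - G (P y))
    (fun y => - (afun gamma mu (P y) * G1 (P y))) c alpha phi.
Proof.
  set (a := afun gamma mu).
  intros H Hmu Ha0 Hphi [Mp [Mpp [[HM [HMp [HMpp _]]] [Hode [Htop Hbot]]]]].
  fold a in Hode.
  assert (Hpos := hod_pos H).
  assert (HcG := cont_in_hod_G H).
  assert (HcG1 := cont_in_hod_G1 H).
  assert (Hca := cont_in_hod_a H).
  assert (HcM : forall p, itv p0 0 p -> cont_in (itv p0 0) M p)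
    by (intros p Hp; apply (D_in_cont_in _ _ _ _ (HM p Hp))).
  exists (fun y => G (P y) * M (P y) + a (P y) ^ 2 * Mp (P y)).
  (* The terms in [M_p] cancel: [G * M] contributes [G * M_p], and differentiating [1 / a] in
     [(a^3 M_p) / a] contributes [- G * M_p]. *)
  exists (fun y => a (P y) * (G1 (P y) * M (P y) + alpha ^ 2 * M (P y))).
  split; [split; [|split; [|split]]|split; [|split]].
  - intros y Hy; destruct (hod_PY H y Hy) as [Hp _].
    apply D_in_ext with (fun z => a (P z) * M (P z)) (fun z => a (P z) *
      (G (P z) / a (P z) * M (P z) + a (P z) * Mp (P z))); auto.
    + intros z Hz; symmetry; apply Hphi, Hz.
    + generalize (Hpos _ Hp); intros; simpl; field; lra.
    + apply (D_in_hod_P H (fun p => a p * M p)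
               (fun p => G p / a p * M p + a p * Mp p) y Hy).
      apply (Dmult _ (fun p => G p / a p) Mp a M).
      * apply (hod_a H _ Hp).
      * apply HM, Hp.
  - intros y Hy; destruct (hod_PY H y Hy) as [Hp _].
    apply continue_in_cont_in.
    apply (cont_in_hod_P H (fun p => G p * M p + a p ^ 2 * Mp p) y Hy).
    apply cont_in_plus; repeat apply cont_in_mult;
      auto using cont_in_const.
    apply continue_in_cont_in, HMp, Hp.
  - intros y Hy; assert (Hy' : itv 0 h y) by (unfold itv; lra).
    destruct (hod_PY H y Hy') as [Hp _].
    assert (Hpi := hod_P_interior H y Hy).
    (* The ODE gives the derivative of [a^3 M_p], so write [a^2 M_p] as
       [(a^3 M_p) / a]. *)
    apply (D_in_is_derive 0 h _
      (fun y => a (P y) * (G1 (P y) * M (P y) + alpha ^ 2 * M (P y))) y Hy).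
    apply (D_in_hod_P H (fun p => G p * M p + a p ^ 2 * Mp p)
             (fun p => G1 p * M p + alpha ^ 2 * M p) y Hy').
    assert (Hode' := proj2 (D_in_is_derive p0 0 (fun q => a q ^ 3 * Mp q)
      (fun p => alpha ^ 2 * a p * M p) _ Hpi) (Hode _ Hpi)).
    assert (Hap : a (P y) <> 0) by (generalize (Hpos _ Hp); lra).
    refine (D_in_ext _ _ _ _ _ _ Hp _ _
      (Dadd _ _ _ _ _ _
        (Dmult _ _ _ _ _ _ (hod_G H _ Hp) (HM _ Hp))
        (Dmult _ _ _ _ _ _ Hode'
          (D_in_inv _ _ _ _ Hp Hap (hod_a H _ Hp))))).
    + intros q Hq; generalize (Hpos _ Hq); intros; simpl; field; lra.
    + simpl; field; exact Hap.
  - intros y Hy; assert (Hy' : itv 0 h y) by (unfold itv; lra).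
    destruct (hod_PY H y Hy') as [Hp _].
    apply (cont_in_interior 0 h _ y Hy).
    apply (cont_in_hod_P H (fun p => a p * (G1 p * M p + alpha ^ 2 * M p)) y Hy').
    apply cont_in_mult; [apply (cont_in_hod_a H), Hp|].
    apply cont_in_plus; apply cont_in_mult;
      auto using cont_in_const.
  - intros y Hy; rewrite Hphi by (unfold itv; lra); ring.
  - rewrite Hphi by apply (hod_itv H).
    (* At the surface [U - c = - sqrt mu] and [U' = - G 0], so both sides equal
       [G 0 * M 0 + g * M 0 / sqrt mu]. *)
    rewrite (hod_P_surface H); fold a in Ha0; rewrite Ha0.
    rewrite (Rpower_3_2 _ Hmu) in Htop.
    assert (Hs := sqrt_lt_R0 _ Hmu).
    replace (Mp 0) with (g * M 0 / sqrt mu ^ 3) by (rewrite <- Htop; field; lra).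
    field; split; lra.
  - rewrite Hphi by apply (hod_itv H).
    rewrite (hod_P_bottom H), Hbot; ring.
Qed.

Lemma bifurcation_of_rayleigh (p0 h g alpha c mu : R) (gamma G G1 Y P M phi : R -> R) :
  hodograph p0 h G G1 (afun gamma mu) Y P ->
  0 < mu -> afun gamma mu 0 = sqrt mu ->
  (forall p, itv p0 0 p -> M p = phi (Y p) / afun gamma mu p) ->
  rayleigh_solution h g (fun y => c - afun gamma mu (P y)) (fun y => - G (P y))
    (fun y => - (afun gamma mu (P y) * G1 (P y))) c alpha phi ->
  bifurcation_solution gamma p0 g alpha mu M.
Proof.
  set (a := afun gamma mu).
  intros H Hmu Ha0 HMphi [phi1 [phi2 [[Hphi [Hphi1 [Hphi2 _]]] [Hode [Htop Hbot]]]]].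
  assert (Hpos := hod_pos H).
  assert (HcG := cont_in_hod_G H).
  assert (Hca := cont_in_hod_a H).
  assert (Hcinv := cont_in_hod_inv_a H).
  assert (Hinv := fun p (Hp : itv p0 0 p) => D_in_inv _ _ _ _ Hp
    (Rgt_not_eq _ _ (Hpos p Hp)) (hod_a H p Hp)).
  assert (HDphi := fun p (Hp : itv p0 0 p) =>
    D_in_hod_Y H _ _ p Hp (Hphi _ (proj1 (hod_YP H p Hp)))).
  (* The derivative of [phi (Y p) / a p], using [Y' = 1 / a] and [a' = G / a]. *)
  set (Mp := fun p => (a p * phi1 (Y p) - G p * phi (Y p)) * / a p ^ 3).
  (* Obtained by expanding [(a^3 M_p)_p = alpha^2 a M] and solving for the second derivative;
     written with sums and products only, to suit the continuity lemmas. *)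
  set (Mpp := fun p => / a p * / a p * (alpha ^ 2 * M p + - 3 * (G p * Mp p))).
  assert (HM : derive_on p0 0 M Mp).
  { intros p Hp.
    refine (D_in_ext _ _ _ _ _ _ Hp _ _
      (Dmult _ _ _ _ _ _ (HDphi p Hp) (Hinv p Hp))).
    - intros q Hq; symmetry; apply HMphi, Hq.
    - generalize (Hpos _ Hp); intros; unfold Mp; simpl; field; lra. }
  assert (HMpc : forall p, itv p0 0 p -> cont_in (itv p0 0) Mp p).
  { intros p Hp; destruct (hod_YP H p Hp) as [HY _].
    apply cont_in_ext with (fun p => (a p * phi1 (Y p) + -1 * (G p * phi (Y p)))
       * (/ a p * (/ a p * / a p))).
    - exact Hp.
    - intros q Hq; generalize (Hpos _ Hq); intros; unfold Mp; field; lra.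
    - apply cont_in_mult; [apply cont_in_plus|]; repeat apply cont_in_mult;
        auto using cont_in_const.
      + apply (cont_in_hod_Y H); [exact Hp|].
        apply continue_in_cont_in, Hphi1, HY.
      + apply (D_in_cont_in _ _ _ _ (HDphi p Hp)). }
  (* In the derivative of [a * phi1 (Y) - G * phi (Y)] the two terms [G * phi1 (Y) / a] cancel,
     leaving [phi2 (Y) - G1 * phi (Y)], which Rayleigh's equation turns into [alpha^2 * phi (Y)]. *)
  assert (Hode' : forall p, p0 < p < 0 ->
    D_in (fun q => a q ^ 3 * Mp q) (fun q => alpha ^ 2 * a q * M q) (itv p0 0) p).
  { intros p Hpi; assert (Hp : itv p0 0 p) by (unfold itv; lra).
    assert (HYi := hod_Y_interior H p Hpi).
    destruct (hod_YP H p Hp) as [HY HPY].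
    assert (Hap := Hpos p Hp).
    assert (D1 := D_in_hod_Y H _ _ p Hp
      (proj2 (D_in_is_derive 0 h phi1 phi2 _ HYi) (Hphi2 _ HYi))).
    refine (D_in_ext _ _ _ _ _ _ Hp _ _
      (Dminus _ _ _ _ _ _
        (Dmult _ _ _ _ _ _ (hod_a H p Hp) D1)
        (Dmult _ _ _ _ _ _ (hod_G H p Hp) (HDphi p Hp)))).
    - intros q Hq; generalize (Hpos _ Hq); intros; unfold Mp; simpl; field; lra.
    - specialize (Hode _ HYi); rewrite HPY in Hode.
      rewrite (HMphi p Hp); fold a in Hode |- *.
      (* Since [U - c = - a] never vanishes, Rayleigh's equation can be solved for the second
         derivative. *)
      assert (E : phi2 (Y p) = alpha ^ 2 * phi (Y p) + G1 p * phi (Y p)).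
      { apply Rmult_eq_reg_l with (a p); [|lra].
        apply Rminus_diag_uniq; rewrite <- Ropp_0, <- Hode; ring. }
      simpl; rewrite E; field; lra. }
  exists Mp, Mpp; split; [split; [exact HM|split; [|split]]|split; [|split]].
  - intros p Hp; apply continue_in_cont_in, HMpc, Hp.
  - intros p Hpi; assert (Hp : itv p0 0 p) by (unfold itv; lra).
    apply (D_in_is_derive p0 0 Mp Mpp p Hpi).
    assert (Hap := Hpos p Hp).
    assert (I := Hinv p Hp).
    (* Here [M_p] is the product of [a^3 M_p], whose derivative is now known, with three factors
       [1 / a]. *)
    refine (D_in_ext _ _ _ _ _ _ Hp _ _
      (Dmult _ _ _ _ _ _ (Hode' p Hpi) (Dmult _ _ _ _ _ _ I (Dmult _ _ _ _ _ _ I I)))).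
    + intros q Hq; generalize (Hpos _ Hq); intros; simpl; field; lra.
    + unfold Mpp; simpl; field; lra.
  - intros p Hpi; assert (Hp : itv p0 0 p) by (unfold itv; lra).
    apply (cont_in_interior p0 0 Mpp p Hpi).
    apply cont_in_mult; [apply cont_in_mult; auto | apply cont_in_plus].
    + apply cont_in_mult; [apply cont_in_const | apply (D_in_cont_in _ _ _ _ (HM p Hp))].
    + apply cont_in_mult; [apply cont_in_const | apply cont_in_mult; auto].
  - intros p Hpi; apply (D_in_is_derive p0 0 (fun q => a q ^ 3 * Mp q)
      (fun q => alpha ^ 2 * a q * M q) p Hpi), Hode', Hpi.
  - assert (H0 : itv p0 0 0) by (generalize (hod_p0 H); unfold itv; lra).
    assert (Hs := sqrt_lt_R0 _ Hmu).
    rewrite (Rpower_3_2 _ Hmu), (HMphi 0 H0); unfold Mp; fold a in Ha0.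
    rewrite Ha0, (hod_surface H), Htop, (hod_P_surface H), Ha0.
    field; split; lra.
  - assert (Hp0 : itv p0 0 p0) by (generalize (hod_p0 H); unfold itv; lra).
    rewrite (HMphi p0 Hp0), (hod_bottom H), Hbot.
    unfold Rdiv; ring.
Qed.

(** * The flow associated with the vorticity function *)

Lemma derive_on_reflect (b : R) (f f1 : R -> R) :
  b <= 0 -> derive_on 0 (Rabs b) f f1 ->
  derive_on b 0 (fun x => f (- x)) (fun x => - f1 (- x)).
Proof.
  intros Hb Hf x Hx.
  rewrite (Rabs_left1 b Hb) in Hf.
  refine (D_in_ext _ _ _ _ _ _ Hx (fun _ _ => eq_refl) _
    (D_in_comp _ (itv 0 (- b)) _ f _ f1 x _ (Dopp _ _ _ _ (Dx _ x)) (Hf _ _))).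
  - simpl; ring.
  - unfold itv; intros; lra.
  - unfold itv in *; lra.
Qed.

Lemma cont_on_reflect (b : R) (f : R -> R) :
  b <= 0 -> cont_on 0 (Rabs b) f -> cont_on b 0 (fun x => - f (- x)).
Proof.
  intros Hb Hf x Hx.
  rewrite (Rabs_left1 b Hb) in Hf.
  apply continue_in_cont_in.
  apply cont_in_ext with (fun x => (-1) * f (- x)); [exact Hx | intros; ring|].
  apply cont_in_mult; [apply cont_in_const|].
  apply cont_in_comp with (itv 0 (- b)).
  - unfold itv; intros; lra.
  - apply (D_in_cont_in _ _ _ _ (Dopp _ _ _ _ (Dx _ x))).
  - apply continue_in_cont_in, Hf; unfold itv in *; lra.
Qed.

(** Comparing the integrand with the constant [/ A] shows that the primitive shrinks distances by at
    most the factor [A], hence that its inverse is [A]-Lipschitz. *)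
Lemma Rabs_le_RInt_lower_bound (a b A : R) (f : R -> R) (u x y : R) :
  cont_on a b f -> 0 < A -> (forall z, itv a b z -> / A <= f z) ->
  itv a b u -> itv a b x -> itv a b y ->
  Rabs (x - y) <= A * Rabs (RInt f u x - RInt f u y).
Proof.
  intros Hf HA Hlow Hu.
  assert (Hle : forall x y, itv a b x -> itv a b y -> x <= y ->
    y - x <= A * (RInt f u y - RInt f u x)).
  { intros s t Hs Ht Hst.
    replace (RInt f u t - RInt f u s) with (RInt f s t).
    - apply Rmult_le_reg_l with (/ A); [apply Rinv_0_lt_compat, HA|].
      rewrite <- Rmult_assoc, Rinv_l, Rmult_1_l by lra.
      replace (/ A * (t - s)) with (RInt (fun _ => / A) s t)
        by (rewrite (RInt_const (V := R_CompleteNormedModule)); apply Rmult_comm).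
      apply RInt_le; [exact Hst | apply ex_RInt_const | |].
      + apply (cont_on_ex_RInt a b); auto.
      + intros z Hz; apply Hlow; unfold itv in *; lra.
    - assert (E : RInt f u s + RInt f s t = RInt f u t); [|lra].
      apply (RInt_Chasles (V := R_CompleteNormedModule));
        apply (cont_on_ex_RInt a b); auto. }
  intros Hx Hy; destruct (Rle_or_lt x y) as [Hxy|Hxy].
  - rewrite (Rabs_minus_sym x y), (Rabs_minus_sym (RInt f u x)), Rabs_pos_eq by lra.
    apply Rle_trans with (1 := Hle x y Hx Hy Hxy).
    apply Rmult_le_compat_l; [lra | apply Rle_abs].
  - rewrite Rabs_pos_eq by lra.
    apply Rle_trans with (1 := Hle y x Hy Hx (Rlt_le _ _ Hxy)).
    apply Rmult_le_compat_l; [lra | apply Rle_abs].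
Qed.

Lemma lipschitz_cont_in (D : R -> Prop) (f : R -> R) (A x : R) :
  0 < A -> (forall y, D y -> Rabs (f y - f x) <= A * Rabs (y - x)) ->
  cont_in D f x.
Proof.
  intros HA Hf; apply continue_in_cont_in; intros eps Heps.
  exists (eps / A); split; [apply Rdiv_lt_0_compat; lra|].
  intros y [[Dy _] Hy]; simpl in *; unfold Rdist in *.
  apply Rle_lt_trans with (1 := Hf y Dy).
  apply Rlt_le_trans with (A * (eps / A)).
  - apply Rmult_lt_compat_l; auto.
  - right; field; lra.
Qed.

(** The delicate field is [P' = a (P)]: the inverse function rule asks for continuity of [pinv]
    beforehand. It follows from a Lipschitz bound, since [Y' = 1 / a] is bounded below by the
    reciprocal of the maximum of [a]. *)
Lemma hodograph_shear (p0 beta mu Gmin : R) (gamma pinv : R -> R) :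
  p0 < 0 -> 0 < beta -> C1_holder 0 (Rabs p0) beta gamma ->
  is_min_on p0 0 (Gam gamma) Gmin -> - 2 * Gmin < mu ->
  is_inverse_y gamma p0 mu pinv ->
  exists G1, hodograph p0 (depth gamma p0 mu) (fun p => gamma (- p)) G1
    (afun gamma mu) (yfun gamma p0 mu) pinv.
Proof.
  intros Hp0 Hb [gamma1 [Hg [K HK]]] [_ Hmin] Hmu [HYP HPY].
  assert (H0 : itv p0 0 0) by (unfold itv; lra).
  assert (Hp0' : itv p0 0 p0) by (unfold itv; lra).
  assert (HG := derive_on_reflect p0 gamma gamma1 (Rlt_le _ _ Hp0) Hg).
  assert (HGam : derive_on p0 0 (Gam gamma) (fun p => gamma (- p))).
  { apply (derive_on_RInt p0 0 (fun p => gamma (- p)) 0); [|exact H0].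
    intros p Hp; apply (cont_deriv _ _ _ _ (HG p Hp)). }
  assert (Hrad : forall p, itv p0 0 p -> 0 < mu + 2 * Gam gamma p)
    by (intros p Hp; generalize (Hmin p Hp); lra).
  assert (Hpos : forall p, itv p0 0 p -> 0 < afun gamma mu p)
    by (intros p Hp; apply sqrt_lt_R0, Hrad, Hp).
  assert (Ha : derive_on p0 0 (afun gamma mu) (fun p => gamma (- p) / afun gamma mu p)).
  { intros p Hp.
    refine (D_in_ext _ _ _ _ _ _ Hp (fun _ _ => eq_refl) _
      (D_in_sqrt _ _ _ _ Hp (Hrad p Hp)
        (Dadd _ _ _ _ _ _ (Dconst _ mu p) (D_in_scal_l _ _ _ 2 _ (HGam p Hp))))).
    generalize (Hpos p Hp); unfold afun; intros; simpl; field; lra. }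
  assert (Hac : cont_on p0 0 (fun p => / afun gamma mu p)).
  { intros p Hp; eapply cont_deriv, D_in_inv; [exact Hp | | apply Ha, Hp].
    generalize (Hpos p Hp); lra. }
  assert (HY : derive_on p0 0 (yfun gamma p0 mu) (fun p => / afun gamma mu p))
    by (apply (derive_on_RInt p0 0 _ p0 Hac Hp0')).
  destruct (cont_on_max p0 0 (afun gamma mu) (Rlt_le _ _ Hp0)) as [A [[pA [HpA EA]] HA]].
  { intros p Hp; apply (cont_deriv _ _ _ _ (Ha p Hp)). }
  assert (HA0 : 0 < A) by (rewrite <- EA; apply Hpos, HpA).
  exists (fun p => - gamma1 (- p)); split; auto.
  (* The Hölder bound on [gamma1] enters through the continuity of [G1]. *)
  - apply cont_on_reflect; [lra|]; apply (holder_cont_on _ _ beta K); auto.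
  - intros y Hy.
    refine (D_in_ext _ _ _ _ _ _ Hy (fun _ _ => eq_refl) _
      (D_in_inverse (itv p0 0) _ _ _ _ y Hy HPY _ _ (HY _ (proj1 (HPY y Hy))))).
    + apply Rinv_inv.
    + apply lipschitz_cont_in with A; [exact HA0|].
      intros z Hz.
      rewrite <- (proj2 (HPY z Hz)) at 2; rewrite <- (proj2 (HPY y Hy)) at 2.
      apply (Rabs_le_RInt_lower_bound p0 0 A); auto; try apply HPY; auto.
      intros p Hp; apply Rinv_le_contravar; auto.
    + apply Rinv_neq_0_compat; generalize (Hpos _ (proj1 (HPY y Hy))); lra.
  - apply (RInt_point (V := R_CompleteNormedModule)).
Qed.

Theorem lemma2p3 :
  forall (g alpha c p0 beta mu Gmin : R) (gamma pinv : R -> R),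
    0 < g -> 0 < alpha -> 0 < c -> p0 < 0 ->
    0 < beta < 1 ->
    C1_holder 0 (Rabs p0) beta gamma ->
    is_min_on p0 0 (Gam gamma) Gmin ->
    - 2 * Gmin < mu ->
    is_inverse_y gamma p0 mu pinv ->
    let h := depth gamma p0 mu in
    let U := shear gamma c mu pinv in
    (exists Umax : R, is_max_on 0 h U Umax /\ Umax < c) /\
    (exists U1 U2 : R -> R,
       C1C2 0 h U U1 U2 /\
       (forall M : R -> R,
          bifurcation_solution gamma p0 g alpha mu M <->
          rayleigh_solution h g U U1 U2 c alpha
            (fun y => (c - U y) * M (pinv y))) /\
       (forall phi : R -> R,
          rayleigh_solution h g U U1 U2 c alpha phi ->
          exists M : R -> R,
            bifurcation_solution gamma p0 g alpha mu M /\
            forall y, itv 0 h y -> phi y = (c - U y) * M (pinv y))).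
Proof.
  intros g alpha c p0 beta mu Gmin gamma pinv _ _ _ Hp0 [Hb _] Hg Hmin Hmu Hinv h U.
  destruct (hodograph_shear p0 beta mu Gmin gamma pinv Hp0 Hb Hg Hmin Hmu Hinv)
    as [G1 H].
  fold h in H.
  assert (EU : forall y, c - U y = afun gamma mu (pinv y))
    by (intros y; unfold U, shear, afun; ring).
  assert (EG : Gam gamma 0 = 0) by apply (RInt_point (V := R_CompleteNormedModule)).
  assert (H0 : itv p0 0 0) by (unfold itv; lra).
  (* As [Gam gamma 0 = 0], the minimum [Gmin] is at most 0, so [mu > - 2 * Gmin >= 0]. *)
  assert (Hmu0 : 0 < mu) by (generalize (proj2 Hmin 0 H0); lra).
  assert (Ha0 : afun gamma mu 0 = sqrt mu)
    by (unfold afun; rewrite EG; f_equal; ring).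
  assert (HU := C1C2_shear H c).
  split.
  - destruct (cont_on_max 0 h U) as [m [[y [Hy Em]] Hm]].
    + apply (hod_itv H).
    + intros y Hy; apply (cont_deriv _ _ _ _ (proj1 HU y Hy)).
    (* The maximum is attained at some [y], where [c - U y = a (P y)] is positive; hence the strict
       bound. *)
    + exists m; split; [split; [exists y|]; auto|].
      generalize (hod_pos H _ (proj1 (hod_PY H y Hy))).
      rewrite <- Em, <- EU; lra.
  - do 2 eexists; split; [exact HU|split].
    + intros M; split; intros HM.
      * apply (rayleigh_of_bifurcation p0 h g alpha c mu gamma
          (fun p => gamma (- p)) G1 (yfun gamma p0 mu) pinv M); auto.
        intros y _; rewrite EU; reflexivity.
      * refine (bifurcation_of_rayleigh _ _ _ _ _ _ _ _ _ _ _ _ _ H Hmu0 Ha0 _ HM).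
        intros p Hp; rewrite EU, (proj2 (hod_YP H p Hp)).
        generalize (hod_pos H p Hp); intros; field; lra.
    + intros phi Hphi.
      (* This choice is forced by [phi y = a (P y) * M (P y)] at [y = Y p]. *)
      exists (fun p => phi (yfun gamma p0 mu p) / afun gamma mu p); split.
      * exact (bifurcation_of_rayleigh _ _ _ _ _ _ _ _ _ _ _ _ _ H Hmu0 Ha0
          (fun _ _ => eq_refl) Hphi).
      * intros y Hy; destruct (hod_PY H y Hy) as [Hp E].
        rewrite EU, E; generalize (hod_pos H _ Hp); intros; field; lra.
Qed.
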